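(* Let $\varepsilon>0$ and let $G$ be a nonempty graph with $\rho(G)\geq\exp(e/\varepsilon)$. If $k$ is a real number with $1\leq k\leq\rho(G)/\ln\rho(G)$, then $p^\ast(G,k)\leq\varepsilon$.
   Context: All graphs are finite and simple. $\mathbb{N}=\{0,1,2,\ldots\}$ and $[k]=\{1,\ldots,k\}$. The density of a nonempty graph $G$ is $d(G)=|E(G)|/|V(G)|$; the maximum density is $\rho(G)=\max_{G'} d(G')$, the maximum being over all nonempty subgraphs $G'$ of $G$. The letter $e$ in $\exp(e/\varepsilon)$ is the base of the natural logarithm $\ln$. A (DP-)cover of $G$ is a pair $\mathcal{H}=(L,H)$ where $H$ is a graph and $L:V(G)\to 2^{V(H)}$ is such that: $\{L(v):v\in V(G)\}$ is a partition of $V(H)$ into $|V(G)|$ independent sets; for each edge $uv\in E(G)$ the edges of $H$ between $L(u)$ and $L(v)$ form a matching; and $H$ has no other edges than those between $L(u)$ and $L(v)$ with $uv\in E(G)$. For $b\in\mathbb{N}$, a $b$-fold transversal of $\mathcal{H}$ is a set $T\subseteq V(H)$ with $|L(v)\cap T|=b$ for every $v\in V(G)$; it is independent if it is an independent set in $H$. $G$ is $(\mathcal{H},b)$-colorable if $\mathcal{H}$ has an independent $b$-fold transversal. For $a\in\mathbb{N}$, the random $a$-fold cover $\mathcal{H}(G,a)=(L,H)$ is defined by $L(v)=\{(v,i):i\in[a]\}$ for $v\in V(G)$ and, independently for each edge $uv\in E(G)$, the edges of $H$ between $L(u)$ and $L(v)$ form a perfect matching chosen uniformly at random among the $a!$ perfect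 matchings between $L(u)$ and $L(v)$ ($H$ has no other edges). $G$ is $(a,b)$-DP-colorable with probability $p$ if $\mathbb{P}(G\text{ is }(\mathcal{H}(G,a),b)\text{-colorable})=p$. For real $k\geq 1$, $$p^\ast(G,k)=\sup\{p:\ \exists\, a,b\in\mathbb{N}\text{ such that } a/b\leq k\text{ and }G\text{ is }(a,b)\text{-DP-colorable with probability }p\},$$ where $b\geq 1$ so that $a/b$ makes sense. *)

(* Defs.v *)
From mathcomp Require Import boolp classical_sets reals sequences exp.
From mathcomp Require Import all_boot all_order all_algebra.

Set Implicit Arguments.
Unset Strict Implicit.
Unset Printing Implicit Defensive.

Import Order.TTheory GRing.Theory Num.Theory.
Local Open Scope ring_scope.

(* Edges are 2-element sets of vertices. *)
Record graph := Graph {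
  vertex :> finType;
  edges : {set {set vertex}};
  edges_card2 : forall f, f \in edges -> #|f| = 2 }.

Section Graphs.
Variable G : graph.

Definition adj (u v : G) : bool := [set u; v] \in edges G.

Definition independent (A : {set G}) : bool :=
  [forall x in A, forall y in A, ~~ adj x y].

Definition subgraph (S : {set G}) (F : {set {set G}}) : bool :=
  (F \subset edges G) && [forall f in F, f \subset S].

Definition density (R : realType) (S : {set G}) (F : {set {set G}}) : R :=
  #|F|%:R / #|S|%:R.

(* Densities are nonnegative, so the default value 0 does not affect the
   maximum when G is nonempty. *)
Definition max_density (R : realType) : R :=
  \big[Num.max/0]_(P : {set G} * {set {set G}} |
                    (P.1 != finset.set0) && subgraph P.1 P.2)
     density R P.1 P.2.

End Graphs.

Section Matchings.
Variable W : finType.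
Implicit Types (A B : {set W}) (M : {set {set W}}).

Definition pairs A B : {set {set W}} := [set [set x; y] | x in A, y in B].

Definition perfect_matching A B M : bool :=
  [&& M \subset pairs A B, finset.trivIset M & finset.cover M == A :|: B].

End Matchings.

(* The lists are a partition indexed by V(G): they may be empty, so that 0-fold
   covers are allowed. *)
Record dpcover (G : graph) := DPCover {
  cgraph : graph;
  clist : G -> {set cgraph};
  clist_disjoint : forall u v, u != v -> [disjoint clist u & clist v];
  clist_cover : \bigcup_(v : G) clist v = [set: cgraph];
  clist_indep : forall v, independent (clist v);
  cmatching : forall u v, adj u v ->
    finset.trivIset (edges cgraph :&: pairs (clist u) (clist v));
  cedges_only : forall m, m \in edges cgraph ->
    exists u v, adj u v /\ m \in pairs (clist u) (clist v) }.

Definition fold_transversal (G : graph) (H : dpcover G) (b : nat)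
    (T : {set cgraph H}) : bool :=
  [forall v : G, #|clist H v :&: T| == b].

Definition colorable (G : graph) (H : dpcover G) (b : nat) : bool :=
  [exists T : {set cgraph H}, fold_transversal b T && independent T].

Section RandomCover.
Variables (G : graph) (a : nat).

Definition edge : finType := {f : {set G} | f \in edges G}.

Definition rlist (v : G) : {set G * 'I_a} := [set (v, i) | i : 'I_a].

(* The perfect matchings between L(u) and L(v), where f = {u, v}. *)
Definition rmatchings (f : {set G}) : {set {set {set G * 'I_a}}} :=
  [set M | [forall u, forall v, (f == [set u; v]) ==>
              perfect_matching (rlist u) (rlist v) M]].

(* The sample space: one perfect matching for each edge of G. *)
Definition outcome : finType :=
  {M : {ffun edge -> {set {set G * 'I_a}}} |
     M \in family (fun f : edge => rmatchings (val f))}.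

Definition redges (w : outcome) : {set {set G * 'I_a}} :=
  \bigcup_(f : edge) val w f.

Lemma mem_rlist v x : (x \in rlist v) = (x.1 == v).
Proof.
apply/imsetP/eqP => [[i _ ->] //|<-]; by exists x.2 => //; case: x.
Qed.

Lemma adj_neq (u v : G) : adj u v -> u != v.
Proof. by move=> /edges_card2; rewrite cards2; case: (u != v). Qed.

Lemma pairs_rlistP u v m :
  reflect (exists i j, m = [set (u, i); (v, j)]) (m \in pairs (rlist u) (rlist v)).
Proof.
apply: (iffP imset2P) => [[x y /imsetP[i _ ->] /imsetP[j _ ->] ->]|[i [j ->]]].
  by exists i, j.
by exists (u, i) (v, j); rewrite ?mem_rlist.
Qed.

Lemma outcome_perfect (w : outcome) (f : edge) u v :
  val f = [set u; v] -> perfect_matching (rlist u) (rlist v) (val w f).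
Proof.
move=> fuv; move/familyP: (valP w) => /(_ f).
by rewrite !inE => /forallP/(_ u)/forallP/(_ v)/implyP; apply; rewrite fuv.
Qed.

Lemma redgesP (w : outcome) m : m \in redges w ->
  exists (f : edge) u v, [/\ val f = [set u; v], m \in val w f, u != v &
    exists i j, m = [set (u, i); (v, j)]].
Proof.
case/bigcupP => f _ mf; have /eqP/cards2P[u [v [uv fuv]]] := edges_card2 (valP f).
exists f, u, v; split => //; apply/pairs_rlistP.
by case/and3P: (outcome_perfect w fuv) => /subsetP-/(_ _ mf).
Qed.

Lemma redges_card2 (w : outcome) m : m \in redges w -> #|m| = 2.
Proof.
by case/redgesP=> f [u [v [_ _ uv [i [j ->]]]]]; rewrite cards2 xpair_eqE (negPf uv).
Qed.

Definition rgraph (w : outcome) : graph := Graph (@redges_card2 w).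

Lemma rlist_disjoint u v : u != v -> [disjoint rlist u & rlist v].
Proof.
move=> uv; apply/pred0P => x /=; rewrite !mem_rlist.
by case: eqP => //= ->; rewrite (negPf uv).
Qed.

Lemma rlist_cover : \bigcup_(v : G) rlist v = [set: G * 'I_a].
Proof.
apply/setP=> x; rewrite inE; apply/bigcupP.
by exists x.1 => //; rewrite mem_rlist.
Qed.

Lemma set2_fst (u v u' v' : G) (i j i' j' : 'I_a) :
  [set (u, i); (v, j)] = [set (u', i'); (v', j')] -> [set u; v] = [set u'; v'].
Proof.
by move/(congr1 (fun A : {set G * 'I_a} => [set x.1 | x in A])); rewrite !imsetU1 !imset_set1.
Qed.

Lemma rlist_indep (w : outcome) v : @independent (rgraph w) (rlist v).
Proof.
apply/forall_inP => x; rewrite mem_rlist => /eqP xv.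
apply/forall_inP => y; rewrite mem_rlist => /eqP yv.
apply/negP => /redgesP[f [u [u' [_ _ uu' [i [j]]]]]].
case: x xv y yv => x k /= -> [y l] /= -> /set2_fst/(congr1 (fun A : {set G} => #|A|)).
by rewrite !cards2 uu' eqxx.
Qed.

Lemma rmatching (w : outcome) u v : adj u v ->
  finset.trivIset (edges (rgraph w) :&: pairs (rlist u) (rlist v)).
Proof.
move=> uv; pose f : edge := exist _ [set u; v] uv.
have /and3P[_ triv _] := @outcome_perfect w f u v erefl.
apply: (trivIsetS _ triv); apply/subsetP => m; rewrite inE.
case/andP => /redgesP[f' [x [y [fxy mf _ [i [j mij]]]]]].
case/pairs_rlistP => k [l]; rewrite {1}mij => /set2_fst xy.
by have -> : f = f' by apply: val_inj; rewrite fxy xy.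
Qed.

Lemma redges_only (w : outcome) m : m \in edges (rgraph w) ->
  exists u v, adj u v /\ m \in pairs (rlist u) (rlist v).
Proof.
case/redgesP=> f [u [v [fuv _ _ mij]]]; exists u, v; split.
  by rewrite /adj -fuv; exact: valP.
exact/pairs_rlistP.
Qed.

Definition random_cover (w : outcome) : dpcover G :=
  @DPCover G (rgraph w) rlist rlist_disjoint rlist_cover
    (rlist_indep w) (@rmatching w) (@redges_only w).

(* The product, over the edges, of the uniform distributions on the perfect
   matchings. *)
Definition outcome_prob (R : realType) (w : outcome) : R :=
  \prod_(f : edge) #|rmatchings (val f)|%:R^-1.

Definition cover_prob (R : realType) (E : pred (dpcover G)) : R :=
  \sum_(w : outcome | E (random_cover w)) outcome_prob R w.

End RandomCover.

Definition dp_colorable_prob (R : realType) (G : graph) (a b : nat) : R :=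
  cover_prob a R (fun H : dpcover G => colorable H b).

Definition pstar (R : realType) (G : graph) (k : R) : R :=
  sup [set p | exists a b : nat,
    [/\ (1 <= b)%N, a%:R / b%:R <= k & dp_colorable_prob R G a b = p]]%classic.

(* Main.v *)
Require Import Defs.
From mathcomp Require Import boolp classical_sets reals sequences exp.
From mathcomp Require Import fingroup perm.
From mathcomp Require Import all_boot all_order all_algebra.
From mathcomp Require Import ring.

Set Implicit Arguments.
Unset Strict Implicit.
Unset Printing Implicit Defensive.

Import Order.TTheory GRing.Theory Num.Theory.
Local Open Scope ring_scope.

(** The proof is a first moment computation on a densest subgraph.

    Fix [a >= b >= 1] with [x = a / b <= k], and a subgraph with vertex set [S]
    and edge set [F] such that [#|F| = rho * #|S|].  An independent [b]-fold
    transversal restricts to a choice of [b] colours in each list over [S], in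
    such a way that no edge of the cover over [F] joins two chosen colours.
    There are ['C(a, b) ^ #|S|] such choices.  In a uniform perfect matching
    between two lists of size [a], the partners of [b] given colours form a
    uniform [b]-set, so they miss [b] given colours of the other list with
    probability [q = 'C(a - b, b) / 'C(a, b)] (card_perm_disjoint,
    card_rmatchings_avoiding).  The matchings over distinct edges being
    independent (prob_forall_edges), the union bound gives
    [P(colorable) <= 'C(a, b) ^ #|S| * q ^ #|F|] (colorable_prob_le).

    From ['C(a, b) <= (e * x) ^ b] and [q <= exp(- b / a) ^ b], this is at most
    [(e * x * exp(- rho / x)) ^ (b * #|S|)].  Since [x <= rho / ln rho], one has
    [exp(- rho / x) <= 1 / rho], so that the base is at most [e / ln rho], which
    the hypothesis on [rho] makes at most [eps] (first_moment_le).  When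
    [eps <= 1] the power is then at most [eps] as well; the case [eps > 1] is
    trivial, and for [a < b] there is no [b]-fold transversal. *)

(** * Permutations mapping a set off another *)

Lemma exists_perm_imset (T : finType) (A B : {set T}) :
  #|A| = #|B| -> exists s : {perm T}, s @: A = B.
Proof.
move=> cAB.
(* Listing A first in one enumeration and B first in another, the permutation
   matches equal positions. *)
pose enum_first (C : {set T}) := enum C ++ enum (~: C).
have sz C : size (enum_first C) = #|T| by rewrite size_cat -!cardE cardsC.
have mem C x : x \in enum_first C by rewrite mem_cat !mem_enum inE orbN.
have un C : uniq (enum_first C).
  rewrite cat_uniq !enum_uniq /= andbT; apply/hasPn => x.
  by rewrite !mem_enum inE.
pose h x := nth x (enum_first B) (index x (enum_first A)).
have lth x : (index x (enum_first A) < size (enum_first B))%N.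
  by rewrite sz -(sz A) index_mem.
have inj_h : injective h.
  move=> x y; rewrite /h (set_nth_default y x (lth x)) => /eqP.
  rewrite nth_uniq // => /eqP exy.
  by rewrite -(nth_index x (mem A x)) exy nth_index.
exists (perm inj_h); apply/eqP; rewrite eqEcard; apply/andP; split.
  apply/subsetP => _ /imsetP[x xA ->]; rewrite permE /h.
  have lx : (index x (enum_first A) < size (enum B))%N.
    by rewrite index_cat mem_enum xA -cardE -cAB cardE index_mem mem_enum.
  by rewrite nth_cat lx -mem_enum mem_nth.
by rewrite card_imset ?cAB //; exact: perm_inj.
Qed.

(** Double counting of the pairs [(s, C)] with [#|C| = #|B|] and [s @: A]
    disjoint from [C]: each [s] is in ['C(#|T| - #|A|, #|B|)] pairs, and the
    number of [s] paired with [C] is the same for all [C], because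
    right multiplication by a permutation taking [B] to [C] is a bijection. *)
Lemma card_perm_disjoint (T : finType) (A B : {set T}) :
  (#|[set s : {perm T} | [disjoint s @: A & B]]| * 'C(#|T|, #|B|) =
   (#|T|)`! * 'C(#|T| - #|A|, #|B|))%N.
Proof.
pose N (C : {set T}) := (\sum_(s : {perm T}) [disjoint s @: A & C])%N.
have NB : #|[set s : {perm T} | [disjoint s @: A & B]]| = N B.
  by rewrite -sum1dep_card /N big_mkcond /=; apply: eq_bigr => s _; case: ifP.
have N_const (C : {set T}) : #|C| = #|B| -> N C = N B.
  move=> /esym/exists_perm_imset[t <-].
  rewrite /N (reindex_inj (mulIg t)) /=; apply: eq_bigr => s _; congr nat_of_bool.
  have -> : (s * t)%g @: A = t @: (s @: A).
    by rewrite -imset_comp; apply: eq_imset => x; rewrite permM.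
  by rewrite imset_disjoint //; exact: perm_inj.
have card_perms : #|{perm T}| = (#|T|)`!.
  rewrite -cardsT -card_perm; apply: eq_card => s; rewrite !inE.
  by apply/esym/subsetP => x; rewrite inE.
rewrite {}NB mulnC -card_draws -sum_nat_const.
under eq_bigr => C do [rewrite inE => /eqP cC; rewrite -(N_const C cC)].
rewrite exchange_big /= -card_perms -sum_nat_const; apply: eq_bigr => s _.
have -> : (#|T| - #|A| = #|~: (s @: A)|)%N.
  by rewrite -(cardsC (s @: A)) card_imset ?addKn //; exact: perm_inj.
rewrite -cards_draws -sum1dep_card big_mkcond [RHS]big_mkcond /=.
apply: eq_bigr => C _; rewrite inE -disjoints_subset disjoint_sym andbC.
by case: eqP => //= _; case: disjoint.
Qed.

(** * Perfect matchings between two lists *)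

Definition matching_of (G : graph) (a : nat) (u v : G) (s : {perm 'I_a}) :
    {set {set G * 'I_a}} :=
  [set [set (u, i); (v, s i)] | i : 'I_a].

Section Matchings.
Variables (G : graph) (a : nat).
Implicit Types (u v : G) (X : {ffun G -> {set 'I_a}}).
Implicit Types (s : {perm 'I_a}) (M : {set {set G * 'I_a}}).

Lemma set2_pair_inj u v (i j i' j' : 'I_a) : u != v ->
  [set (u, i); (v, j)] = [set (u, i'); (v, j')] -> i = i' /\ j = j'.
Proof.
move=> uv /setP e; split.
  have := e (u, i); rewrite !inE eqxx /= !xpair_eqE eqxx (negPf uv) orbF /=.
  by move/esym/eqP.
have := e (v, j); rewrite !inE eqxx /= !xpair_eqE eqxx eq_sym (negPf uv) orbT /=.
by move/esym/eqP.
Qed.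

Lemma mem_matching_of u v s i : [set (u, i); (v, s i)] \in matching_of u v s.
Proof. by apply/imsetP; exists i. Qed.

Lemma matching_of_inj u v : u != v -> injective (@matching_of G a u v).
Proof.
move=> uv s t e; apply/perm.permP => i.
have : [set (u, i); (v, s i)] \in matching_of u v t by rewrite -e mem_matching_of.
by case/imsetP => j _ /(set2_pair_inj uv)[-> ->].
Qed.

Lemma perfect_matching_sym (A B : {set G * 'I_a}) M :
  perfect_matching A B M = perfect_matching B A M.
Proof.
rewrite /perfect_matching finset.setUC; congr (_ && _).
suff -> : pairs A B = pairs B A by [].
apply/setP => m; apply/imset2P/imset2P => -[x y xA yB ->];
  by exists y x => //; rewrite finset.setUC.
Qed.

(** [rmatchings] quantifies over both orientations of an edge; by symmetry of
    [perfect_matching] either one determines it. *)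
Lemma mem_rmatchings u v M : u != v ->
  (M \in rmatchings a [set u; v]) = perfect_matching (rlist a u) (rlist a v) M.
Proof.
move=> uv; rewrite inE; apply/'forall_forallP/idP => [/(_ u v)|pm x y].
  by rewrite eqxx.
apply/implyP => /eqP e.
have xuv : x \in [set u; v] by rewrite e !inE eqxx.
have yuv : y \in [set u; v] by rewrite e !inE eqxx orbT.
have : #|[set x; y]| = 2 by rewrite -e cards2 uv.
rewrite cards2; case: eqVneq => // xy _.
move: xuv yuv xy; rewrite !inE => /orP[]/eqP-> /orP[]/eqP->;
  by rewrite ?eqxx // perfect_matching_sym.
Qed.

Lemma matching_of_perfect u v s : u != v ->
  perfect_matching (rlist a u) (rlist a v) (matching_of u v s).
Proof.
move=> uv; apply/and3P; split.
- by apply/subsetP => _ /imsetP[i _ ->]; apply/pairs_rlistP; exists i, (s i).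
- apply/trivIsetP => _ _ /imsetP[i _ ->] /imsetP[j _ ->] ne.
  have ij : i != j by apply: contraNneq ne => ->.
  rewrite -setI_eq0; apply/eqP/setP => -[x k]; rewrite !inE !xpair_eqE.
  apply/negbTE/negP => /andP[/orP[]/andP[/eqP-> /eqP->]];
    rewrite eqxx ?(negPf uv) /= ?orbF ?(inj_eq perm_inj) ?(negPf ij) //=.
  by rewrite eq_sym (negPf uv).
- apply/eqP/setP => -[x k]; rewrite in_setU !mem_rlist /=.
  apply/bigcupP/orP => [[_ /imsetP[i _ ->]]|[]/eqP->].
  + by rewrite !inE !xpair_eqE => /orP[]/andP[-> _]; [left|right].
  + by exists [set (u, k); (v, s k)]; rewrite ?mem_matching_of // !inE eqxx.
  + exists [set (u, (s^-1)%g k); (v, s ((s^-1)%g k))]; first exact: mem_matching_of.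
    by rewrite permKV !inE eqxx orbT.
Qed.

(** The permutation sends [i] to the colour [j] of the partner of [(u, i)];
    triviality of the intersections makes it injective and determines [M]. *)
Lemma perfect_matchingE u v M : u != v ->
  perfect_matching (rlist a u) (rlist a v) M -> exists s, M = matching_of u v s.
Proof.
move=> uv /and3P[/subsetP sub triv /eqP cov].
have partner i : exists j, [set (u, i); (v, j)] \in M.
  have : (u, i) \in finset.cover M by rewrite cov in_setU mem_rlist eqxx.
  case/bigcupP => m mM; have /pairs_rlistP[i' [j mE]] := sub _ mM.
  rewrite mE !inE !xpair_eqE (negPf uv) orbF eqxx /= => /eqP e.
  by exists j; rewrite e -mE.
pose h i := xchoose (partner i).
have hM i : [set (u, i); (v, h i)] \in M := xchooseP (partner i).
have meet m m' x : m \in M -> m' \in M -> x \in m -> x \in m' -> m = m'.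
  by move=> mM mM' xm xm'; rewrite -(def_pblock triv mM xm) (def_pblock triv mM' xm').
have inj_h : injective h.
  move=> i j e.
  have := @meet _ _ (v, h i) (hM i) (hM j); rewrite !inE e eqxx !orbT.
  by move=> /(_ isT isT) /(set2_pair_inj uv)[].
exists (perm inj_h); apply/setP => m; apply/idP/imsetP => [mM|[i _ ->]]; last first.
  by rewrite permE.
have /pairs_rlistP[i [j mE]] := sub _ mM.
exists i => //; rewrite permE; apply: (@meet _ _ (u, i)) => //.
  by rewrite mE !inE eqxx.
by rewrite !inE eqxx.
Qed.

Lemma rmatchings_perms u v : u != v ->
  rmatchings a [set u; v] = matching_of u v @: [set: {perm 'I_a}].
Proof.
move=> uv; apply/setP => M; rewrite mem_rmatchings //.
apply/idP/imsetP => [/(perfect_matchingE uv)[s ->]|[s _ ->]]; first by exists s.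
exact: matching_of_perfect.
Qed.

(** [X v] is the set of colours chosen in the list of [v]. *)
Definition avoids (X : {ffun G -> {set 'I_a}}) M :=
  [forall m in M, ~~ (m \subset [set p | p.2 \in X p.1])].

Lemma avoids_matching_of X u v s :
  avoids X (matching_of u v s) = [disjoint s @: X u & X v].
Proof.
apply/forall_inP/pred0P => [av j|dis _ /imsetP[i _ ->]].
  apply/negP => /andP[/imsetP[i iu ->] sv].
  have /negP[] := av _ (mem_matching_of u v s i).
  by apply/subsetP => p; rewrite !inE => /orP[]/eqP->.
apply/negP => /subsetP sub; have /negP[] := negbT (dis (s i)) => /=.
have := sub (u, i); have := sub (v, s i); rewrite !inE !eqxx orbT /=.
by move=> /(_ isT) -> /(_ isT) iu; rewrite imset_f.
Qed.

Lemma card_rmatchings (f : {set G}) : f \in edges G -> #|rmatchings a f| = a`!.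
Proof.
move/edges_card2/eqP/cards2P => [u [v [uv ->]]].
by rewrite rmatchings_perms // card_imset ?cardsT ?card_Sn //; exact: matching_of_inj.
Qed.

Lemma card_rmatchings_avoiding (f : {set G}) X b : f \in edges G ->
  (forall v, v \in f -> #|X v| = b) ->
  (#|[set M in rmatchings a f | avoids X M]| * 'C(a, b) = a`! * 'C(a - b, b))%N.
Proof.
move/edges_card2/eqP/cards2P => [u [v [uv ->]]] cX.
have cu : #|X u| = b by rewrite cX // !inE eqxx.
have cv : #|X v| = b by rewrite cX // !inE eqxx orbT.
have := card_perm_disjoint (X u) (X v); rewrite card_ord cu cv => <-.
congr (_ * _)%N; rewrite -(card_imset _ (@matching_of_inj u v uv)).
apply: eq_card => M; rewrite inE rmatchings_perms //.
apply/andP/imsetP => [[/imsetP[s _ ->] av]|[s + ->]].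
  by exists s; rewrite // inE -avoids_matching_of.
by rewrite inE -avoids_matching_of => av; split=> //; exact: imset_f.
Qed.

End Matchings.

(** * The first moment bound *)

Section RandomCovers.
Variables (R : realType) (G : graph) (a : nat).
Implicit Types (w : outcome G a) (F : {set {set G}}).

(** Independence of the matchings over distinct edges: expanding the product
    of sums gives back the sum over outcomes. *)
Lemma prob_forall_edges (Q : edge G -> pred {set {set G * 'I_a}}) :
  \sum_(w : outcome G a | [forall f, Q f (val w f)]) outcome_prob R w =
  \prod_(f : edge G) (#|[set M in rmatchings a (val f) | Q f M]|%:R / (a`!)%:R).
Proof.
pose A := [pred M : {ffun edge G -> _} |
  M \in family (fun f : edge G => rmatchings a (val f))].
pose p (M : {ffun edge G -> {set {set G * 'I_a}}}) : R :=
  \prod_(f : edge G) #|rmatchings a (val f)|%:R^-1.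
rewrite -[LHS](big_sub_cond A (fun M => [forall f, Q f (M f)]) p).
transitivity (\prod_(f : edge G)
    \sum_(M | M \in [set M in rmatchings a (val f) | Q f M]) ((a`!)%:R^-1 : R)).
  rewrite bigA_distr_big_dep; apply: eq_big => [M|M _].
    apply/andP/familyP => [[/familyP rM /forallP QM] f|rM].
      by rewrite unfold_in /= inE rM QM.
    split; first by apply/familyP => f; have := rM f; rewrite unfold_in /= inE => /andP[].
    by apply/forallP => f; have := rM f; rewrite unfold_in /= inE => /andP[].
  by apply: eq_bigr => f _; rewrite (card_rmatchings a (valP f)).
by apply: eq_bigr => f _; rewrite sumr_const mulr_natl.
Qed.

Lemma outcome_prob_ge0 w : 0 <= outcome_prob R w.
Proof. by apply: prodr_ge0 => f _; rewrite invr_ge0. Qed.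

Lemma sum_outcome_prob : \sum_(w : outcome G a) outcome_prob R w = 1.
Proof.
transitivity (\sum_(w : outcome G a | [forall f : edge G, true]) outcome_prob R w).
  by apply: eq_bigl => w; apply/esym/forallP.
rewrite (prob_forall_edges (fun _ _ => true)) big1 // => f _.
have -> : #|[set M in rmatchings a (val f) | true]| = a`!.
  rewrite -(card_rmatchings a (valP f)); apply: eq_card => M.
  by rewrite [LHS]inE andbT.
by rewrite divff // pnatr_eq0 -lt0n fact_gt0.
Qed.

Lemma prob_avoids (b : nat) (F : {set {set G}}) (X : {ffun G -> {set 'I_a}}) :
  (b <= a)%N -> F \subset edges G ->
  (forall f v, f \in F -> v \in f -> #|X v| = b) ->
  \sum_(w : outcome G a | [forall f : edge G, (val f \in F) ==> avoids X (val w f)])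
     outcome_prob R w = ('C(a - b, b)%:R / 'C(a, b)%:R) ^+ #|F|.
Proof.
move=> ba FE cX.
rewrite (prob_forall_edges (fun f M => (val f \in F) ==> avoids X M)).
transitivity (\prod_(f : edge G | val f \in F) ('C(a - b, b)%:R / 'C(a, b)%:R : R)).
  rewrite [RHS]big_mkcond /=; apply: eq_bigr => f _.
  have a_neq0 : (a`!)%:R != 0 :> R by rewrite pnatr_eq0 -lt0n fact_gt0.
  have [fF|fF] := boolP (val f \in F); last first.
    have -> : #|[set M in rmatchings a (val f) | false ==> avoids X M]| = a`!.
      rewrite -(card_rmatchings a (valP f)); apply: eq_card => M.
      by rewrite [LHS]inE /= andbT.
    by rewrite divff.
  have /= := card_rmatchings_avoiding (valP f) (fun v => cX _ v fF).
  move=> /(congr1 (fun n => n%:R : R)); rewrite !natrM => e.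
  have C_neq0 : 'C(a, b)%:R != 0 :> R by rewrite pnatr_eq0 -lt0n bin_gt0.
  by apply/eqP; rewrite eqr_div // e mulrC.
rewrite prodr_const; congr (_ ^+ _); rewrite -(card_imset _ val_inj).
apply: eq_card => f; apply/imsetP/idP => [[g + ->]//|fF].
by exists (exist _ f (subsetP FE _ fF)).
Qed.

(** The empty choice outside of [S] makes a selection determined by its values
    on [S], so that only [#|S|] lists contribute to the count. *)
Definition selections (b : nat) (S : {set G}) : {set {ffun G -> {set 'I_a}}} :=
  [set X | X \in family (fun v : G =>
     [pred A : {set 'I_a} | #|A| == (if v \in S then b else 0%N)])].

Lemma card_selections (b : nat) (S : {set G}) :
  #|selections b S| = ('C(a, b) ^ #|S|)%N.
Proof.
rewrite cardsE card_family foldrE big_image /= -prod_nat_const [RHS]big_mkcond /=.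
apply: eq_bigr => v _; have := card_draws 'I_a (if v \in S then b else 0).
by rewrite card_ord cardsE => ->; case: ifP; rewrite ?bin0.
Qed.

(** The traces on [S] of an independent transversal [T] form a selection; an
    edge of the cover inside the selection would lie inside [T]. *)
Lemma colorable_selection (b : nat) (S : {set G}) F w :
  colorable (random_cover w) b ->
  exists2 X, X \in selections b S &
    [forall f : edge G, (val f \in F) ==> avoids X (val w f)].
Proof.
move=> /existsP[T /andP[/forallP bT /forall_inP indT]].
exists [ffun v => if v \in S then [set i | (v, i) \in T] else finset.set0].
  rewrite inE; apply/familyP => v; rewrite inE ffunE; case: ifP => _; last by rewrite cards0.
  rewrite -(eqP (bT v)); apply/eqP.
  have pair_inj : injective (fun i : 'I_a => (v, i)) by move=> i j [].
  rewrite -(card_imset _ pair_inj); apply: eq_card => -[x i].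
  rewrite in_setI (mem_rlist v (x, i)) /=.
  apply/imsetP/andP => [[j + [-> ->]]|[/eqP -> xT]]; first by rewrite inE eqxx.
  by exists i; rewrite ?inE.
apply/forallP => f; apply/implyP => fF; apply/forall_inP => m mf.
apply/negP => /subsetP mX.
have mw : m \in redges w by apply/bigcupP; exists f.
have mT x : x \in m -> x \in T.
  by move=> /mX; rewrite inE ffunE; case: ifP; rewrite ?inE //; case: x.
have [_ [u [v [_ _ _ [i [j mE]]]]]] := redgesP mw.
have uT : (u, i) \in T by rewrite mT // mE !inE eqxx.
have vT : (v, j) \in T by rewrite mT // mE !inE eqxx orbT.
by have /forall_inP/(_ _ vT)/negP[] := indT _ uT; rewrite /adj -mE.
Qed.

(** Union bound over the selections on [S]. *)
Lemma colorable_prob_le (b : nat) (S : {set G}) F : (b <= a)%N -> subgraph S F ->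
  dp_colorable_prob R G a b <=
  'C(a, b)%:R ^+ #|S| * ('C(a - b, b)%:R / 'C(a, b)%:R) ^+ #|F|.
Proof.
move=> ba SF; have /andP[FE /forall_inP FS] := SF.
pose good X w := [forall f : edge G, (val f \in F) ==> avoids X (val w f)].
apply: (@le_trans _ _ (\sum_(X in selections b S)
    \sum_(w : outcome G a | good X w) outcome_prob R w)).
  rewrite /dp_colorable_prob /cover_prob big_mkcond.
  under [leRHS]eq_bigr do rewrite big_mkcond.
  rewrite exchange_big /=; apply: ler_sum => w _.
  case: ifP => [/(colorable_selection S F)[X XS gX]|_]; last first.
    by apply: sumr_ge0 => X _; case: ifP => // _; exact: outcome_prob_ge0.
  rewrite (bigD1 X) //= [good X w]gX lerDl.
  by apply: sumr_ge0 => Y _; case: ifP => // _; exact: outcome_prob_ge0.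
rewrite -natrX -card_selections mulr_natl -sumr_const; apply: ler_sum => X.
rewrite inE => /familyP XS; rewrite (prob_avoids ba FE) // => f v fF vf.
by have /eqP := XS v; rewrite (subsetP (FS f fF)).
Qed.

Lemma colorable_prob_le1 (b : nat) : dp_colorable_prob R G a b <= 1.
Proof.
rewrite -sum_outcome_prob [leRHS](bigID (fun w => colorable (random_cover w) b)) /=.
by rewrite lerDl sumr_ge0 // => w _; exact: outcome_prob_ge0.
Qed.

Lemma colorable_prob0 (b : nat) : (0 < #|G|)%N -> (a < b)%N ->
  dp_colorable_prob R G a b = 0.
Proof.
move=> /card_gt0P[v _] ab; apply: big_pred0 => w.
apply/negbTE/negP => w_col; have [X] := colorable_selection [set: G] finset.set0 w_col.
rewrite inE => /familyP/(_ v) /eqP + _; rewrite inE => cX.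
by have := max_card (mem (X v)); rewrite card_ord cX leqNgt ab.
Qed.

End RandomCovers.

(** * Estimates *)

Section Estimates.
Variable R : realType.

Lemma ffact_ratio_le (a b j : nat) :
  ((a - b) ^_ j * a ^ j <= a ^_ j * (a - b) ^ j)%N.
Proof.
elim: j => // j IHj; rewrite !ffactnSr !expnSr mulnACA [leqRHS]mulnACA leq_mul //.
rewrite mulnBl (mulnBl a j) [(a * (a - b))%N]mulnC leq_sub2l //.
by rewrite leq_mul2l leq_subr orbT.
Qed.

(** The ratio is a product of [b] factors [(a - b - i) / (a - i)], each at most
    [1 - b / a <= exp(- b / a)]. *)
Lemma bin_ratio_le (a b : nat) : (0 < a)%N -> (b <= a)%N ->
  'C(a - b, b)%:R / 'C(a, b)%:R <= expR (- (b%:R / a%:R)) ^+ b :> R.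
Proof.
move=> a_gt0 ba.
have C_gt0 : 0 < 'C(a, b)%:R :> R by rewrite ltr0n bin_gt0.
have a_gt0' : 0 < a%:R :> R by rewrite ltr0n.
apply: (@le_trans _ _ ((1 - b%:R / a%:R) ^+ b)); last first.
  apply: lerXn2r; rewrite ?nnegrE ?expR_ge0 ?expR_ge1Dx //.
  by rewrite subr_ge0 ler_pdivrMr // mul1r ler_nat.
have -> : 1 - b%:R / a%:R = (a - b)%:R / a%:R :> R.
  by rewrite natrB // mulrBl divff // gt_eqF.
rewrite expr_div_n ler_pdivrMr // mulrAC ler_pdivlMr ?exprn_gt0 //.
rewrite -!natrX -!natrM ler_nat -(leq_pmul2r (fact_gt0 b)) mulnAC bin_ffact.
by rewrite -mulnA bin_ffact [leqRHS]mulnC ffact_ratio_le.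
Qed.

Lemma ffact_le_expn (a b : nat) : (a ^_ b <= a ^ b)%N.
Proof.
by elim: b => // b IHb; rewrite ffactnSr expnSr leq_mul // leq_subr.
Qed.

(** ['C(a, b) <= a ^ b / b!], and [b ^ b / b!] is one term of the exponential
    series of [b]. *)
Lemma bin_le_expR (a b : nat) : (0 < b)%N ->
  'C(a, b)%:R <= (expR 1 * (a%:R / b%:R)) ^+ b :> R.
Proof.
move=> b_gt0.
have b_gt0' : 0 < b%:R :> R by rewrite ltr0n.
have f_gt0 : 0 < (b`!)%:R :> R by rewrite ltr0n fact_gt0.
rewrite -(ler_pM2r f_gt0) -natrM bin_ffact.
apply: (@le_trans _ _ (a%:R ^+ b)); first by rewrite -natrX ler_nat ffact_le_expn.
have b_pow_le : b%:R ^+ b <= expR 1 ^+ b * (b`!)%:R :> R.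
  rewrite -ler_pdivrMr // -expRM_natr mul1r.
  have := @expR_ge1Dxn R b%:R b.-1 (ler0n _ _); rewrite prednK //.
  by apply: le_trans; rewrite lerDr.
have -> : (expR 1 * (a%:R / b%:R)) ^+ b * (b`!)%:R =
    a%:R ^+ b * (expR 1 ^+ b * (b`!)%:R / b%:R ^+ b) :> R.
  by rewrite exprMn expr_div_n; ring.
by rewrite ler_peMr ?exprn_ge0 // ler_pdivlMr ?exprn_gt0 // mul1r.
Qed.

(** With [x = a / b] the left side is at most [(e * x * exp(- rho / x)) ^ (b * n)].
    As [x * ln rho <= rho], the base is at most
    [e * x / rho <= e / ln rho <= eps]. *)
Lemma first_moment_le (eps rho k : R) (a b n m : nat) :
  (0 < b)%N -> (b <= a)%N -> (0 < n)%N -> eps <= 1 -> 0 < eps ->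
  rho = m%:R / n%:R -> expR (expR 1 / eps) <= rho ->
  a%:R / b%:R <= k -> k <= rho / ln rho ->
  'C(a, b)%:R ^+ n * ('C(a - b, b)%:R / 'C(a, b)%:R) ^+ m <= eps.
Proof.
move=> b_gt0 ba n_gt0 eps_le1 eps_gt0 rhoE rho_ge ab_le k_le.
have a_gt0 : (0 < a)%N := leq_trans b_gt0 ba.
have rho_gt0 : 0 < rho := lt_le_trans (expR_gt0 _) rho_ge.
have ln_ge : expR 1 / eps <= ln rho by rewrite -ler_expR lnK.
have ln_gt0 : 0 < ln rho by rewrite (lt_le_trans _ ln_ge) // divr_gt0 // expR_gt0.
set x : R := a%:R / b%:R in ab_le.
have x_gt0 : 0 < x by rewrite divr_gt0 ?ltr0n.
have x_le : x <= rho / ln rho := le_trans ab_le k_le.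
have xln_le : x * ln rho <= rho by rewrite -ler_pdivlMr.
have base_le : expR 1 * x * expR (- (rho / x)) <= eps.
  have exp_le : expR (- (rho / x)) <= rho^-1.
    rewrite expRN lef_pV2 ?posrE ?expR_gt0 // -{1}[rho]lnK //.
    by rewrite ler_expR ler_pdivlMr // mulrC.
  apply: (@le_trans _ _ (expR 1 * x * rho^-1)).
    by rewrite ler_pM2l // mulr_gt0 // expR_gt0.
  have e_le : expR 1 <= eps * ln rho by rewrite mulrC -ler_pdivrMr.
  rewrite ler_pdivrMr //; apply: (@le_trans _ _ (eps * ln rho * x)).
    by rewrite ler_pM2r.
  by rewrite -mulrA ler_pM2l // mulrC.
have ex_ge0 : 0 <= expR 1 * x by rewrite mulr_ge0 ?expR_ge0 ?ltW.
have mE : m%:R = rho * n%:R by rewrite rhoE divfK // pnatr_eq0 -lt0n.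
apply: (@le_trans _ _ ((expR 1 * x * expR (- (rho / x))) ^+ (b * n))).
  have -> : (expR 1 * x * expR (- (rho / x))) ^+ (b * n) =
      ((expR 1 * x) ^+ b) ^+ n * (expR (- (b%:R / a%:R)) ^+ b) ^+ m.
    rewrite exprMn -!exprM; congr (_ * _); rewrite -!expRM_natr; congr expR.
    rewrite !natrM mE invf_div; field.
    by rewrite pnatr_eq0 -lt0n.
  apply: ler_pM; rewrite ?exprn_ge0 ?divr_ge0 //.
    apply: lerXn2r; rewrite ?nnegrE ?exprn_ge0 //; exact: bin_le_expR.
  apply: lerXn2r; rewrite ?nnegrE ?divr_ge0 ?exprn_ge0 ?expR_ge0 //.
  exact: bin_ratio_le.
have base_ge0 : 0 <= expR 1 * x * expR (- (rho / x)).
  by rewrite mulr_ge0 ?expR_ge0.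
apply: (@le_trans _ _ (eps ^+ (b * n))); first by apply: lerXn2r; rewrite ?nnegrE // ltW.
have bn_gt0 : (0 < b * n)%N by rewrite muln_gt0 b_gt0.
by rewrite -(prednK bn_gt0) exprS ler_piMr ?exprn_ile1 // ltW.
Qed.

End Estimates.

(** * Conclusion *)

(** Positivity rules out that the maximum is its default value [0]. *)
Lemma max_density_attained (R : realType) (G : graph) : 0 < max_density G R ->
  exists (S : {set G}) F,
    [/\ S != finset.set0, subgraph S F & max_density G R = density R S F].
Proof.
rewrite /max_density.
pose K (r : R) := 0 < r -> exists (S : {set G}) F,
  [/\ S != finset.set0, subgraph S F & r = density R S F].
apply: (big_ind K) => [|x y Kx Ky|[S F] /andP[S0 SF] _]; rewrite /K ?ltxx //.
  by rewrite -/(K _); case: (leP x y).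
by exists S, F.
Qed.

Theorem proposition1p9 (R : realType) (eps : R) (G : graph) (k : R)
    (eps_gt0 : 0 < eps) (G_nonempty : (0 < #|{: G}|)%N)
    (rho_ge : expR (expR 1 / eps) <= max_density G R)
    (k_ge1 : 1 <= k)
    (k_le : k <= max_density G R / ln (max_density G R)) :
  pstar G k <= eps.
Proof.
apply: ge_sup.
  (* The supremum is over a nonempty set: take a = 0 and b = 1. *)
  exists (dp_colorable_prob R G 0 1), 0%N, 1%N; split=> //.
  by rewrite mul0r (le_trans _ k_ge1).
move=> _ [a [b [b_gt0 ab_le <-]]].
have [eps_le1|/ltW eps_ge1] := leP eps 1; last first.
  exact: le_trans (colorable_prob_le1 R G a b) eps_ge1.
have [ba|ab] := leqP b a; last by rewrite colorable_prob0 // ltW.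
have rho_gt0 := lt_le_trans (expR_gt0 _) rho_ge.
have [S [F [S0 SF rhoE]]] := max_density_attained rho_gt0.
apply: le_trans (colorable_prob_le R ba SF) _.
by apply: first_moment_le rhoE rho_ge ab_le k_le => //; rewrite card_gt0.
Qed.
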